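(* Let $f=f(\boldsymbol\xi;t,\boldsymbol x)$, with $f(\cdot;t,\boldsymbol x)\in M$, be the exact solution of the kinetic equation $\frac{\partial f}{\partial t}+\boldsymbol v(\boldsymbol\xi)\cdot\nabla_{\boldsymbol x}f=Q[f]$, and let $\hat f=\hat f(\boldsymbol\xi;\boldsymbol\omega(t,\boldsymbol x))$, with values in $M$, be the approximate solution given by the reduced model, with residual $\mathcal R[\hat f(\cdot;\boldsymbol\omega)]$. Put $\delta f:=\hat f(\cdot;\boldsymbol\omega)-f$. Suppose that for a given $p\in(1,\infty)$ the collision operator $Q$ satisfies $$\int_{\boldsymbol\Xi}|f_1-f_2|^{p-1}|Q[f_1]-Q[f_2]|\,\mathrm d\mu(\boldsymbol\xi)\le L_Q\int_{\boldsymbol\Xi}|f_1-f_2|^p\,\mathrm d\mu(\boldsymbol\xi)\quad\forall f_1,f_2\in M,$$ where $L_Q$ is a positive constant. Then the following error estimate holds: $$\|\delta f\|_p(T)\le \|\delta f\|_p(0)+\int_0^Te^{L_Q(T-\tau)}\,\|\mathcal R[\hat f(\cdot;\boldsymbol\omega(\tau,\cdot))]\|_p\,\mathrm d\tau .$$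
   Context: Setting: $t$ is time, $\boldsymbol x\in\mathbb R^d$, $\boldsymbol\xi\in\boldsymbol\Xi$ (a manifold carrying a measure $\mu$), $\boldsymbol v:\boldsymbol\Xi\to\mathbb R^d$, $M$ is an open subset of a topological vector space $V$ of real-valued functions on $\boldsymbol\Xi$, and $Q:M\to V$. Reduced model: the ansatz manifold is $\hat M=\{\hat f(\cdot;\boldsymbol\omega):\boldsymbol\omega=(\omega^1,\dots,\omega^n)\in\mathbb R^n\}\subset M$, with tangent space at $\hat f(\cdot;\boldsymbol\omega)$ spanned by $\partial\hat f/\partial\omega^k$, $k=1,\dots,n$. Let $\mathbb P_{\boldsymbol\omega}$ be a linear projection of $V$ onto this tangent space. The parameters $\boldsymbol\omega(t,\boldsymbol x)$ solve the reduced model $$\frac{\partial}{\partial t}\hat f(\cdot;\boldsymbol\omega)+\mathbb P_{\boldsymbol\omega}\big(\boldsymbol v\cdot\nabla_{\boldsymbol x}\hat f(\cdot;\boldsymbol\omega)\big)=\mathbb P_{\boldsymbol\omega}Q[\hat f(\cdot;\boldsymbol\omega)].$$ Residual: $\mathcal R[\hat f(\cdot;\boldsymbol\omega)]:=\big(\frac{\partial}{\partial t}+\boldsymbol v(\boldsymbol\xi)\cdot\nabla_{\boldsymbol x}\big)\hat f(\boldsymbol\xi;\boldsymbol\omega)-Q[\hat f(\cdot;\boldsymbol\omega)]=(\mathrm{id}-\mathbb P_{\boldsymbol\omega})\big(\boldsymbol v(\boldsymbol\xi)\cdot\nabla_{\boldsymbol x}\hat f(\boldsymbol\xi;\boldsymbol\omega)-Q[\hat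 f(\cdot;\boldsymbol\omega)]\big)$. Norm: $\|h\|_p=\big(\int_{\mathbb R^d}\int_{\boldsymbol\Xi}|h|^p\,\mathrm d\mu(\boldsymbol\xi)\,\mathrm d\boldsymbol x\big)^{1/p}$ at a fixed time; $\|\delta f\|_p(T)$ is this norm at time $T$. Standing assumption: the solutions decay sufficiently fast at infinity to avoid boundary terms, so that $\int_{\mathbb R^d}\int_{\boldsymbol\Xi}\boldsymbol v(\boldsymbol\xi)\cdot\nabla_{\boldsymbol x}|\delta f|^p\,\mathrm d\mu(\boldsymbol\xi)\,\mathrm d\boldsymbol x=0$.
   Formalization: The initial error carries the factor e^{L_Q T}, without which the estimate is false; solutions are classical, Q[f̂] is measurable, v·∇|δf|^p is integrable, and ∂_t|δf|^p is bounded by a time-independent integrable function. *)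

(* Defs.v *)
From HB Require Import structures.
From mathcomp Require Import all_boot all_order all_algebra.
From mathcomp Require Import all_classical all_reals all_analysis.
From mathcomp Require Import ring.

Set Implicit Arguments.
Unset Strict Implicit.
Unset Printing Implicit Defensive.

Import Order.TTheory GRing.Theory Num.Theory.
Import numFieldNormedType.Exports.

Local Open Scope classical_set_scope.
Local Open Scope ring_scope.

(* The library has no measurable structure on row vectors: we put on 'rV_d the
   sigma-algebra generated by the coordinates, i.e. the Borel one. *)
Definition rV_display : measure_display -> measure_display.
Proof. exact. Qed.

Section measurable_rV.
Context (R : realType) (d : nat).

Let coord (i : 'I_d) (x : 'rV[R]_d) : R := x ord0 i.

Let rV_set0 : g_sigma_preimage coord set0.
Proof. exact: sigma_algebra0. Qed.

Let rV_setC A : g_sigma_preimage coord A -> g_sigma_preimage coord (~` A).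
Proof. exact: sigma_algebraC. Qed.

Let rV_bigcup (F : (set 'rV[R]_d)^nat) :
  (forall i, g_sigma_preimage coord (F i)) ->
  g_sigma_preimage coord (\bigcup_i F i).
Proof. exact: sigma_algebra_bigcup. Qed.

HB.instance Definition _ := @isMeasurable.Build (rV_display default_measure_display)
  'rV[R]_d (g_sigma_preimage coord) rV_set0 rV_setC rV_bigcup.

Lemma measurable_coord_rV (i : 'I_d) :
  measurable_fun [set: 'rV[R]_d] (fun x : 'rV[R]_d => x ord0 i).
Proof.
move=> _ Y mY; rewrite setTI; apply: sub_sigma_algebra => /=.
rewrite -bigcup_seq/=; exists i => /=; first by rewrite mem_index_enum.
by exists Y => //; rewrite setTI.
Qed.

Lemma measurable_fun_rVP d1 (T : measurableType d1) (f : T -> 'rV[R]_d) :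
  (forall i, measurable_fun setT (fun t => f t ord0 i)) ->
  measurable_fun setT f.
Proof.
move=> mf; apply: (@measurability _ _ _ 'rV[R]_d setT f
  (\big[setU/set0]_(i < d) preimage_set_system setT (coord i) measurable)) => //.
move=> _ [B + <-]; rewrite -bigcup_seq => -[i _ [C mC <-]].
by rewrite !setTI; have := mf i measurableT _ mC; rewrite setTI.
Qed.

End measurable_rV.

Section lebesgue_rV.
Context (R : realType).

Definition rV_cons n (z : R * 'rV[R]_n) : 'rV[R]_n.+1 :=
  \row_i oapp (fun j => z.2 ord0 j) z.1 (unlift ord0 i).

Definition rV_uncons n (x : 'rV[R]_n.+1) : R * 'rV[R]_n :=
  (x ord0 ord0, \row_j x ord0 (lift ord0 j)).

Lemma rV_consK n : cancel (@rV_cons n) (@rV_uncons n).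
Proof.
move=> [a x]; rewrite /rV_uncons /rV_cons !mxE unlift_none; congr pair.
by apply/rowP => j; rewrite !mxE liftK.
Qed.

Lemma measurable_rV_cons n : measurable_fun setT (@rV_cons n).
Proof.
apply: measurable_fun_rVP => i.
under eq_fun do rewrite mxE.
case: unliftP => [j|] _ /=; last exact: measurable_fst.
by apply: (measurableT_comp (measurable_coord_rV j)); exact: measurable_snd.
Qed.

Lemma measurable_rV_uncons n : measurable_fun setT (@rV_uncons n).
Proof.
apply: measurable_fun_pair; first exact: measurable_coord_rV.
apply: measurable_fun_rVP => i.
under eq_fun do rewrite mxE.
exact: measurable_coord_rV.
Qed.

Section step.
Context n (m : {sigma_finite_measure set 'rV[R]_n -> \bar R}).

Definition lebesgue_rVS : set 'rV[R]_n.+1 -> \bar R :=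
  pushforward (lebesgue_measure \x m)%E (@rV_cons n).

Let lebesgue_rVS0 : lebesgue_rVS set0 = 0%E.
Proof. by rewrite /lebesgue_rVS /pushforward preimage_set0 measure0. Qed.

Let lebesgue_rVS_ge0 A : (0 <= lebesgue_rVS A)%E.
Proof. by rewrite /lebesgue_rVS /pushforward; exact: measure_ge0. Qed.

Let lebesgue_rVS_sigma_additive : semi_sigma_additive lebesgue_rVS.
Proof.
move=> F mF tF mUF; rewrite /lebesgue_rVS /pushforward preimage_bigcup.
have mcons A : measurable A -> measurable (@rV_cons n @^-1` A).
  by move=> mA; rewrite -[X in measurable X]setTI; exact: measurable_rV_cons.
apply: measure_semi_sigma_additive.
- by move=> k; exact: mcons.
- apply/trivIsetP => /= i j _ _ ij; rewrite -preimage_setI.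
  by move/trivIsetP : tF => /(_ _ _ _ _ ij) ->//; rewrite preimage_set0.
- by rewrite -preimage_bigcup; exact: mcons.
Qed.

HB.instance Definition _ := isMeasure.Build _ _ _ lebesgue_rVS
  lebesgue_rVS0 lebesgue_rVS_ge0 lebesgue_rVS_sigma_additive.

Let lebesgue_rVS_sigma_finite : sigma_finite setT lebesgue_rVS.
Proof.
have /sigma_finiteP[F [TF ndF Foo]] := sigma_finiteT (@lebesgue_measure R).
have /sigma_finiteP[G [TG ndG Goo]] := sigma_finiteT m.
exists (fun k => @rV_uncons n @^-1` (F k `*` G k)).
  rewrite -preimage_bigcup (_ : \bigcup_k _ = setT) ?preimage_setT//.
  apply/seteqP; split=> // -[x y] _.
  have [i _ Fix] : (\bigcup_i F i) x by rewrite -TF.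
  have [j _ Gjy] : (\bigcup_i G i) y by rewrite -TG.
  exists (maxn i j) => //; split=> /=.
  - by move: x Fix; exact/subsetPset/ndF/leq_maxl.
  - by move: y Gjy; exact/subsetPset/ndG/leq_maxr.
move=> k; have [mFk Fkoo] := Foo k; have [mGk Gkoo] := Goo k.
have mFG : measurable (F k `*` G k) by exact: measurableX.
split.
  by rewrite -[X in measurable X]setTI; exact: measurable_rV_uncons.
rewrite /lebesgue_rVS /pushforward -comp_preimage.
rewrite (_ : _ \o _ = id); last by apply/funext => z; exact: rV_consK.
by rewrite preimage_id product_measure1E// lte_mul_pinfty// ge0_fin_numE.
Qed.

HB.instance Definition _ := Measure_isSigmaFinite.Build _ _ _ lebesgue_rVS
  lebesgue_rVS_sigma_finite.

End step.

(* Lebesgue measure on R^d, as the d-fold product of the one-dimensional one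
   (for d = 0, the unit mass at the only point). *)
Fixpoint lebesgue_rV d : {sigma_finite_measure set 'rV[R]_d -> \bar R} :=
  if d is n.+1 then lebesgue_rVS (lebesgue_rV n) else \d_(0 : 'rV[R]_0).

Lemma lebesgue_rV_box d (a b : 'rV[R]_d) :
  (forall i, a ord0 i <= b ord0 i) ->
  lebesgue_rV d [set x | forall i, x ord0 i \in `[a ord0 i, b ord0 i]%R] =
  (\prod_(i < d) (b ord0 i - a ord0 i))%:E.
Proof.
elim: d a b => [|n IHn] a b ab.
  rewrite big_ord0 /= /dirac indicE mem_set//= => i; by case: i.
pose a' : 'rV_n := \row_j a ord0 (lift ord0 j).
pose b' : 'rV_n := \row_j b ord0 (lift ord0 j).
set B := [set x : 'rV_n | forall i, x ord0 i \in `[a' ord0 i, b' ord0 i]%R].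
have mB : measurable B.
  have -> : B = \bigcap_(i in [set: 'I_n])
      ((fun x : 'rV[R]_n => x ord0 i) @^-1` `[a' ord0 i, b' ord0 i]%classic).
    by apply/seteqP; split=> x /= xB i; [move=> _|]; have := xB i; [|apply].
  apply: fin_bigcap_measurable => // i _.
  by rewrite -[X in measurable X]setTI; exact: measurable_coord_rV.
rewrite /= /lebesgue_rVS /pushforward.
rewrite (_ : _ @^-1` _ = `[a ord0 ord0, b ord0 ord0]%classic `*` B); last first.
  apply/seteqP; split=> -[y x] /=.
    move=> H; split=> [|j].
      by have := H ord0; rewrite !mxE unlift_none.
    by have := H (lift ord0 j); rewrite !mxE liftK.
  move=> [/= Hy Hx] i; rewrite !mxE.
  by case: unliftP => [j ->|->] //=; have := Hx j; rewrite !mxE.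
rewrite product_measure1E//= IHn; last by move=> i; rewrite !mxE.
rewrite lebesgue_measure_itv/= lte_fin big_ord_recl.
under eq_bigr do rewrite !mxE.
have := ab ord0; rewrite le_eqVlt => /predU1P[->|->].
  by rewrite ltxx subrr mul0r mul0e.
by rewrite -EFinD -EFinM.
Qed.

End lebesgue_rV.

Section kinetic.
Context (R : realType) (d : nat).
Context (dXi : measure_display) (Xi : measurableType dXi).
Context (mu : {sigma_finite_measure set Xi -> \bar R}).
Context (v : Xi -> 'rV[R]_d).
Context (V : topologicalLmodType R) (ev : {linear V -> (Xi -> R^o)}).

(* Elements of V are abstract; ev turns them into functions on Xi.  A field
   g : R -> 'rV_d -> V is a V-valued function of time and position, and its
   value g(xi; t, x) is ev (g t x) xi. *)
Implicit Types (g h : R -> 'rV[R]_d -> V) (Q : V -> V) (M : set V).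

Definition function_space : Prop :=
  injective ev /\ forall w, measurable_fun setT (ev w).

Definition dt g (t : R) x xi : R := 'D_1 (fun s : R => ev (g s x) xi : R) t.

Definition partial_x (i : 'I_d) (u : 'rV[R]_d -> R) : 'rV[R]_d -> R :=
  'D_(delta_mx ord0 i) u.

Definition transport (u : 'rV[R]_d -> R) (xi : Xi) (x : 'rV[R]_d) : R :=
  \sum_(i < d) v xi ord0 i * partial_x i u x.

Definition v_grad g t x xi : R := transport (fun y => ev (g t y) xi) xi x.

Definition regular_field (T : R) g : Prop :=
  [/\ forall x xi, {within `[0, T], continuous (fun t : R => ev (g t x) xi : R)},
      forall (t : R) x xi, 0 < t < T ->
        derivable (fun s : R => ev (g s x) xi : R) t 1,
      forall (t : R) x xi (i : 'I_d), 0 < t < T ->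
        derivable (fun y => ev (g t y) xi : R) x (delta_mx ord0 i) &
      forall t : R, 0 <= t <= T ->
        measurable_fun setT (fun z : 'rV[R]_d * Xi => ev (g t z.1) z.2)].

Definition kinetic_solution M Q (T : R) f : Prop :=
  [/\ forall (t : R) x, 0 <= t <= T -> M (f t x),
      regular_field T f &
      forall (t : R) x xi, 0 < t < T ->
        dt f t x xi + v_grad f t x xi = ev (Q (f t x)) xi].

Definition residual Q g t (z : 'rV[R]_d * Xi) : R :=
  dt g t z.1 z.2 + v_grad g t z.1 z.2 - ev (Q (g t z.1)) z.2.

Section reduced_model.
Context (n : nat) (fhat : 'rV[R]_n -> V).

Definition partial_ansatz (k : 'I_n) (w : 'rV[R]_n) (xi : Xi) : R :=
  'D_(delta_mx ord0 k) (fun w' => ev (fhat w') xi : R) w.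

Definition ansatz_manifold M : Prop :=
  (forall w, M (fhat w)) /\
  forall w (k : 'I_n), exists u : V, forall xi,
    derivable (fun w' => ev (fhat w') xi : R) w (delta_mx ord0 k) /\
    ev u xi = partial_ansatz k w xi.

Definition tangent_space (w : 'rV[R]_n) : set V :=
  [set u | exists c : 'I_n -> R, forall xi,
    ev u xi = \sum_(k < n) c k * partial_ansatz k w xi].

Definition tangent_projection (P : 'rV[R]_n -> {linear V -> V}) : Prop :=
  forall w, (forall u, tangent_space w (P w u)) /\
            (forall u, tangent_space w u -> P w u = u).

(* The function xi |-> v(xi) . grad_x fhat(xi; omega(t, x)) has to be an element
   a of V for its projection to make sense. *)
Definition reduced_solution Q (P : 'rV[R]_n -> {linear V -> V})
    (T : R) (omega : R -> 'rV[R]_d -> 'rV[R]_n) : Prop :=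
  let g t x := fhat (omega t x) in
  regular_field T g /\
  forall (t : R) x, 0 < t < T -> exists2 a : V,
    (forall xi, ev a xi = v_grad g t x xi) &
    forall xi, dt g t x xi + ev (P (omega t x) a) xi =
               ev (P (omega t x) (Q (g t x))) xi.

Lemma residual_projection Q (P : 'rV[R]_n -> {linear V -> V}) (T : R)
    (omega : R -> 'rV[R]_d -> 'rV[R]_n) :
  let g t x := fhat (omega t x) in
  reduced_solution Q P T omega ->
  forall (t : R) x, 0 < t < T -> exists2 a : V,
    (forall xi, ev a xi = v_grad g t x xi) &
    forall xi, residual Q g t (x, xi) =
      ev ((a - Q (g t x)) - P (omega t x) (a - Q (g t x))) xi.
Proof.
move=> g [_ redE] t x tT; have [a aE PE] := redE t x tT.
exists a => // xi; rewrite /residual /= -aE -(addrK (ev (P (omega t x) a) xi) (dt _ _ _ _)).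
rewrite PE.
have evB b c : ev (b - c) xi = ev b xi - ev c xi by rewrite linearB.
have PB b c : P (omega t x) (b - c) = P (omega t x) b - P (omega t x) c.
  by rewrite linearB.
by rewrite PB !evB; ring.
Qed.

End reduced_model.

Definition collision_lipschitz M Q (p LQ : R) : Prop :=
  forall f1 f2, M f1 -> M f2 ->
  (\int[mu]_xi (`|ev f1 xi - ev f2 xi| `^ (p - 1) *
                `|ev (Q f1) xi - ev (Q f2) xi|)%:E <=
   LQ%:E * \int[mu]_xi (`|ev f1 xi - ev f2 xi| `^ p)%:E)%E.

(* Integrals over R^d x Xi are taken against the product measure; for measurable
   |h|^p this is the iterated integral over Xi and then R^d, by Tonelli. *)
Definition phase_measure : set ('rV[R]_d * Xi) -> \bar R :=
  (lebesgue_rV R d \x mu)%E.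

HB.instance Definition _ := Measure.on phase_measure.

Definition error g h t (z : 'rV[R]_d * Xi) : R :=
  ev (g t z.1) z.2 - ev (h t z.1) z.2.

Definition phase_norm (p : R) (u : 'rV[R]_d * Xi -> R) : \bar R :=
  ('N[phase_measure]_p%:E [EFin \o u])%E.

Definition no_boundary_terms (p T : R) g h : Prop :=
  forall t : R, 0 < t < T ->
  let F (z : 'rV[R]_d * Xi) : R :=
    transport (fun y => `|error g h t (y, z.2)| `^ p) z.2 z.1 in
  phase_measure.-integrable setT (EFin \o F) /\
  (\int[phase_measure]_z (F z)%:E = 0)%E.

(* Decay in phase space, uniform in time, of the time derivative of |g - h|^p:
   it allows differentiation of the p-th power of the norm under the integral. *)
Definition dominated_dt (p T : R) g h : Prop :=
  exists2 G : 'rV[R]_d * Xi -> R,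
    phase_measure.-integrable setT (EFin \o G) &
    forall (t : R) z, 0 < t < T ->
      `|'D_1 (fun s : R => `|error g h s z| `^ p : R) t| <= G z.

End kinetic.

(* Main.v *)
(* Let E(t) be the p-th power of the L^p norm of the error e at time t.  Along the
   two evolution equations, (d/dt) |e|^p + v . grad |e|^p = p |e|^(p-1) sgn(e) (r + q)
   with r the residual and q the difference of the collision terms.  Integrating over
   phase space, the transport term vanishes, Hoelder's inequality bounds the
   contribution of r and the hypothesis on Q the one of q, whence
     E' <= p L E + p E^(1 - 1/p) ||r||_p,
   and the estimate is Gronwall's inequality for E^(1/p).  Nothing makes t |-> ||r||_p
   measurable, so its integral is only a lower integral; it still dominates the
   integral of any measurable function lying below, here of a derivative. *)
Require Import Defs.
From mathcomp Require Import all_boot all_order all_algebra.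
From mathcomp Require Import all_classical all_reals all_analysis.
From mathcomp Require Import measurable_realfun ring lra.

Set Implicit Arguments.
Unset Strict Implicit.
Unset Printing Implicit Defensive.

Import Order.TTheory GRing.Theory Num.Theory.
Import numFieldNormedType.Exports.

Local Open Scope classical_set_scope.
Local Open Scope ring_scope.

(** * Directional derivatives, powers of the absolute value, and difference quotients *)

Lemma derive_line (R : realType) (W : normedModType R) (f : W -> R) x v :
  'D_v f x = 'D_1 (fun h : R => f (h *: v + x)) 0.
Proof.
rewrite /derive; set g1 := fun h => h^-1 *: _; set g2 := fun h => h^-1 *: _.
suff -> : g1 = g2 by [].
by apply/funext => h; rewrite /g1 /g2 /= scaler1 addr0 scale0r add0r.
Qed.

(** Restricting [u] to the line [h *: v + x] turns this into the chain rule in one variable, so [u]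
    needs a derivative in the single direction [v] and no differentiability. *)
Lemma is_derive_comp_dir (R : realType) (W : normedModType R) (phi : R -> R)
    (u : W -> R) (x v : W) (du dphi : R) :
  is_derive x v u du -> is_derive (u x) 1 phi dphi ->
  is_derive x v (phi \o u) (dphi * du).
Proof.
move=> [u1 uE] [p1 pE].
pose w (h : R) := u (h *: v + x).
have w0 : w 0 = u x by rewrite /w scale0r add0r.
have dw : derivable w 0 1 by have /derivable1P := u1.
have dp : derivable phi (w 0) 1 by rewrite w0.
split.
  apply/derivable1P.
  have /derivable1_diffP dw' := dw; have /derivable1_diffP dp' := dp.
  by apply/derivable1_diffP; exact: (differentiable_comp dw' dp').
rewrite derive_line -(derive1E (phi \o w)) derive1_comp//.
by rewrite !derive1E -derive_line uE w0 pE.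
Qed.

(** Away from 0 this is the power rule on either half-line. At 0 the difference quotient has
    absolute value [|h|^(p - 1)], which tends to 0 because [p > 1]; the convention [Num.sg 0 = 0]
    makes the same formula valid there. *)
Lemma is_derive_norm_powR (R : realType) (p x : R) : 1 < p ->
  is_derive x 1 (fun y : R => `|y| `^ p) (p * `|x| `^ (p - 1) * Num.sg x).
Proof.
move=> p1.
have [x0|x0|->] := ltgtP x 0.
- rewrite ltr0_norm// ltr0_sg//.
  have dN : is_derive x 1 (-%R : R -> R) (- 1) by exact: is_deriveNid.
  have Nx0 : 0 < - x by rewrite oppr_gt0.
  have := is_derive_comp_dir dN (@is_derive1_powR R p _ Nx0).
  apply: near_eq_is_derive.
  near=> y; rewrite /= ltr0_norm//; near: y; exact: lt_nbhsl.
- rewrite gtr0_norm// gtr0_sg// mulr1.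
  have := @is_derive1_powR R p _ x0.
  apply: near_eq_is_derive.
  near=> y; rewrite /= gtr0_norm//; near: y; exact: lt_nbhsr.
- rewrite sgr0 mulr0.
  have c : (fun h : R => h^-1 *: (`|(h *: 1 + 0 : R)| `^ p - `|0 : R| `^ p)) @ 0^' --> (0 : R).
    apply/cvgrPdist_lt => e e0; near=> h; rewrite sub0r normrN.
    have h0 : h != 0 by near: h; exact: nbhs_dnbhs_neq.
    rewrite [h *: 1]mulr1 addr0 normr0 powR0 ?subr0; last by rewrite gt_eqF// (lt_trans _ p1).
    rewrite normrM normfV ger0_norm ?powR_ge0//.
    rewrite -(@mulr_powRB1 _ `|h|) ?normr_ge0 ?(lt_trans _ p1)// mulKf ?normr_eq0//.
    (* Writing [e] as a power with exponent [p - 1] reduces the claim to [|h| < e^(1/(p - 1))]. *)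
    have -> : e = (e `^ (p - 1)^-1) `^ (p - 1).
      by rewrite -powRrM mulVf ?powRr1 ?ltW// gt_eqF// subr_gt0.
    rewrite gt0_ltr_powR ?subr_gt0 ?nnegrE ?powR_ge0//.
    by near: h; apply: dnbhs0_lt; rewrite powR_gt0.
  by split; [apply/cvg_ex; exists 0 | apply/cvg_lim].
Unshelve. all: by end_near. Qed.

Lemma is_derive_norm_powR_comp (R : realType) (W : normedModType R)
    (u : W -> R) (x v : W) (p du : R) : 1 < p -> is_derive x v u du ->
  is_derive x v (fun y => `|u y| `^ p) (p * `|u x| `^ (p - 1) * Num.sg (u x) * du).
Proof.
by move=> p1 ud; exact: (is_derive_comp_dir ud (@is_derive_norm_powR R p (u x) p1)).
Qed.

(** Along a sequence of steps a derivative becomes a pointwise limit of a sequence of functions, and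
    such limits preserve measurability. The measurability of every derivative below is obtained in
    this way. *)
Lemma cvg_diff_quotient (R : realType) (W : normedModType R) (u : W -> R) (x v : W)
    (h : R^nat) :
  derivable u x v -> (forall n, h n != 0) -> h @ \oo --> 0 ->
  ((h n)^-1 * (u (h n *: v + x) - u x)) @[n --> \oo] --> 'D_v u x.
Proof.
move=> du h0 hc.
by have /cvgr_dnbhsP := du; apply.
Qed.

Lemma cvg_cst_harmonic (R : realType) (c : R) : (c / n.+1%:R) @[n --> \oo] --> 0.
Proof.
rewrite -[0 in X in _ --> X](mulr0 c).
by apply: cvgM; [exact: cvg_cst | exact: cvg_harmonic].
Qed.

(* Integrals of nonnegative functions are suprema over simple functions below
   them, hence are monotone without any measurability requirement. *)
Lemma ge0_le_integral_nonmeas d (T : measurableType d) (R : realType)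
    (mu : {measure set T -> \bar R}) (A B : set T) (f g : T -> \bar R) :
  A `<=` B -> (forall x, A x -> (0 <= f x)%E) -> (forall x, B x -> (0 <= g x)%E) ->
  (forall x, A x -> (f x <= g x)%E) ->
  (\int[mu]_(x in A) f x <= \int[mu]_(x in B) g x)%E.
Proof.
move=> AB f0 g0 fg; rewrite !ge0_integralE//.
apply: le_ereal_sup => _ [h /= hf <-]; exists h => // x.
apply: (le_trans (hf x)); rewrite /patch.
case: ifPn => [/set_mem Ax|_]; first by rewrite mem_set ?fg//; exact: AB.
by case: ifPn => // /set_mem /g0.
Qed.

Lemma is_derive_shift_arg (R : realType) (y : R -> R) (t h : R) :
  derivable y (h + t) 1 -> is_derive h 1 (fun s => y (s + t)) ('D_1 y (h + t)).
Proof.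
move=> dy; rewrite -[X in is_derive _ _ _ X]mulr1.
have dyt : is_derive (shift t h) 1 y ('D_1 y (h + t)).
  exact: derivableP.
exact: (is_derive_comp_dir (is_derive_shift h 1 t) dyt).
Qed.

Lemma cvg_derive1 (R : realType) (y : R -> R) (t : R) (h : R^nat) :
  derivable y t 1 -> (forall n, h n != 0) -> h @ \oo --> 0 ->
  ((h n)^-1 * (y (h n + t) - y t)) @[n --> \oo] --> 'D_1 y t.
Proof.
move=> dy h0 hc.
have := cvg_diff_quotient dy h0 hc.
by under eq_fun do rewrite [_ *: 1]mulr1.
Qed.

Lemma derivable_continuous (R : realType) (y : R -> R) (t : R) :
  derivable y t 1 -> {for t, continuous y}.
Proof. by move=> /derivable1_diffP/differentiable_continuous. Qed.


(** * The fundamental theorem of calculus for bounded derivatives *)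

Section bounded_derivative.
Context (R : realType).
Notation mu := (@lebesgue_measure R).

Lemma measurable_derive1_itv (y : R -> R) (a b c : R) : b < c ->
  (forall t, a <= t < c -> derivable y t 1) ->
  measurable_fun `[a, b] ('D_1 y).
Proof.
move=> bc dy.
(* Steps below [c - b] keep [h n + t] to the left of [c] for every [t <= b]. *)
pose h n : R := (c - b) / 2 / n.+1%:R.
have bc2 : 0 < (c - b) / 2 by rewrite divr_gt0// subr_gt0.
have h0 n : 0 < h n by rewrite divr_gt0.
have hle n : h n < c - b.
  rewrite /h (@le_lt_trans _ _ ((c - b) / 2))//; last by lra.
  by rewrite ler_pdivrMr// ler_peMr ?ler1n// ltW.
apply: (@measurable_fun_cvg _ _ _ _ (fun n t => (h n)^-1 * (y (h n + t) - y t))).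
  move=> n; apply: measurable_funM => //; apply: measurable_funB.
    apply: subspace_continuous_measurable_fun => //.
    apply: derivable_within_continuous => t; rewrite in_itv/= => /andP[at_ tb].
    under eq_fun do rewrite addrC.
    have dyt : derivable y (t + h n) 1.
      by apply: dy; have := h0 n; have := hle n; move=> *; lra.
    by have [] := is_derive_shift_arg dyt.
  apply: subspace_continuous_measurable_fun => //.
  apply: derivable_within_continuous => t; rewrite in_itv/= => /andP[at_ tb].
  by apply: dy; lra.
move=> t; rewrite /= in_itv/= => /andP[at_ tb]; apply: cvg_derive1.
- by apply: dy; lra.
- by move=> n; rewrite gt_eqF.
- exact: cvg_cst_harmonic.
Qed.

(** The derivative is bounded but possibly discontinuous, so the theorem for continuous integrands
    applies to [y] and not to its derivative. Hence the mean [K h] of the shifted function, the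
    integral of [y (h + t)] over [[a, b]], is differentiated at [h = 0] in two ways. *)
Lemma integral_derive1_bounded (y : R -> R) (u a b v C : R) :
  u < a -> a < b -> b < v ->
  (forall t, u < t < v -> derivable y t 1) ->
  (forall t, u < t < v -> `|'D_1 y t| <= C) ->
  (\int[mu]_(t in `[a, b]) 'D_1 y t)%R = y b - y a.
Proof.
move=> ua ab bv dy yC.
pose c := (u + a) / 2; pose d := (b + v) / 2.
have [uc ca] : u < c /\ c < a by rewrite /c; split; lra.
have [bd dv] : b < d /\ d < v by rewrite /d; split; lra.
(* Shifts of absolute value below [e] keep [[a, b]] inside []c, d[]. *)
pose e := Num.min (a - c) (d - b).
have e0 : 0 < e by rewrite lt_min !subr_gt0 ca.
have [eac edb] : e <= a - c /\ e <= d - b by rewrite !ge_min !lexx orbT.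
have cy t : u < t < v -> {for t, continuous y}.
  by move=> /dy; exact: derivable_continuous.
have iy : mu.-integrable `[c, d] (EFin \o y).
  apply: continuous_compact_integrable; first exact: segment_compact.
  apply: derivable_within_continuous => t; rewrite in_itv/= => tcd.
  by apply: dy; lra.
pose Psi x := (\int[mu]_(t in [set` `[c, x]]) y t)%R.
have dPsi x : c < x < d -> derivable Psi x 1 /\ 'D_1 Psi x = y x.
  move=> /andP[cx xd]; rewrite -derive1E; apply: (continuous_FTC1_closed xd iy cx).
  by apply: cy; lra.
have dPsis x h : c < h + x < d -> is_derive h 1 (fun s => Psi (s + x)) (y (h + x)).
  by move=> /dPsi[d1 <-]; exact: is_derive_shift_arg.
pose K (h : R) := (\int[mu]_(t in `[a, b]) y (h + t))%R.
have KE h : -e < h < e -> K h = Psi (h + b) - Psi (h + a).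
  move=> he.
  have der t : a <= t <= b -> derivable (fun s => Psi (h + s)) t 1.
    move=> tab; have cth : c < t + h < d by lra.
    have [+ _] := dPsis _ _ cth.
    by under eq_fun do rewrite addrC.
  rewrite /K /Rintegral (@continuous_FTC2 _ (fun t => y (h + t)) (fun t => Psi (h + t)))//.
  - apply: derivable_within_continuous => t; rewrite in_itv/= => tab.
    have dyt : derivable y (t + h) 1 by apply: dy; lra.
    have [+ _] := is_derive_shift_arg dyt.
    by under eq_fun do rewrite addrC.
  - split.
    + by move=> t; rewrite in_itv/= => tab; apply: der; lra.
    + by apply: cvg_at_right_filter; apply: (derivable_continuous (der _ _)); lra.
    + by apply: cvg_at_left_filter; apply: (derivable_continuous (der _ _)); lra.
  - move=> t; rewrite in_itv/= => tab.
    have cth : c < t + h < d by lra.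
    rewrite derive1E [h + t]addrC; have [_ <-] := dPsis _ _ cth.
    by congr ('D_1 _ t); apply/funext => s; rewrite addrC.
(* First evaluation: [K] is a difference of two shifts of the primitive [Psi] of [y]. *)
have dK : 'D_1 K 0 = y b - y a.
  have zb : c < 0 + b < d by lra.
  have za : c < 0 + a < d by lra.
  have := is_deriveB (dPsis _ _ zb) (dPsis _ _ za).
  rewrite !add0r => -[_ <-]; apply: near_eq_derive.
  have : 0 \in `]- e, e[ by rewrite in_itv/=; lra.
  move=> /near_in_itvoo; apply: filterS => h; rewrite in_itv/= => he.
  by rewrite KE.
pose f h t := y (h + t).
have cf h : - e < h < e -> {within `[a, b], continuous f h}.
  move=> he; apply: derivable_within_continuous => t; rewrite in_itv/= => tab.
  have dyt : derivable y (t + h) 1 by apply: dy; lra.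
  have [+ _] := is_derive_shift_arg dyt.
  by under eq_fun do rewrite addrC.
have df h t : - e < h < e -> a <= t <= b -> is_derive h 1 (f ^~ t) ('D_1 y (h + t)).
  by move=> he tab; apply: is_derive_shift_arg; apply: dy; lra.
(* Second evaluation: differentiation under the integral sign, dominated by the constant [C]. *)
have df0 : 'D_1 K 0 = (\int[mu]_(t in `[a, b]) partial1of2 f 0 t)%R.
  rewrite -derive1E.
  apply: (@differentiation_under_integral R _ _ mu f `[a, b]%classic _ 0 (- e) e
    _ _ _ (fun=> C)).
  - exact: measurable_itv.
  - by rewrite /= in_itv/=; lra.
  - move=> h; rewrite /= in_itv/= => he.
    by apply: continuous_compact_integrable; [exact: segment_compact|exact: cf].
  - by move=> h t; rewrite /= !in_itv/= => he tab; have [] := df _ _ he tab.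
  - by move=> _; apply: le_trans (yC a _) => //; lra.
  - apply: measurable_bounded_integrable.
    + exact: measurable_itv.
    + by rewrite /= lebesgue_measure_itv/=; case: ifP => // _; rewrite -EFinD ltry.
    + exact: measurable_cst.
    + exact: bounded_cst.
  - move=> h t; rewrite /= !in_itv/= => he tab.
    by rewrite partial1of2E; have [_ ->] := df _ _ he tab; apply: yC; lra.
rewrite -dK df0; apply: eq_Rintegral => t; rewrite inE/= in_itv/= => tab.
rewrite partial1of2E; have e00 : - e < 0 < e by lra.
by have [_ ->] := df _ _ e00 tab; rewrite add0r.
Qed.

(** On a segment inside []a, b[] the increment of [y] is the integral of its derivative, a
    measurable function below [m]; continuity of [y] then reaches the endpoints. No measurability of
    [m] enters. *)
Lemma le_integral_derive1 (y : R -> R) (m : R -> \bar R) (a b C : R) : a < b ->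
  {within `[a, b], continuous y} ->
  (forall t, a < t < b -> derivable y t 1) ->
  (forall t, a < t < b -> `|'D_1 y t| <= C) ->
  (forall t, (0 <= m t)%E) ->
  (forall t, a < t < b -> (('D_1 y t)%:E <= m t)%E) ->
  ((y b)%:E <= (y a)%:E + \int[mu]_(t in `[a, b]) m t)%E.
Proof.
move=> ab cy dy yC m0 ym.
set I := (\int[mu]_(t in _) m t)%E.
have I0 : (0 <= I)%E by exact: integral_ge0.
have [->|Ifin] := eqVneq I +oo%E; first by rewrite addey// leey.
have IE : I = (fine I)%:E by rewrite fineK// ge0_fin_numE// ltey.
have step s t : a < s -> s < t -> t < b -> y t - y s <= fine I.
  move=> as_ st tb; rewrite -lee_fin -IE.
  rewrite -(integral_derive1_bounded as_ st tb dy yC).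
  have my : measurable_fun `[s, t] ('D_1 y).
    by apply: (measurable_derive1_itv tb) => x xst; apply: dy; lra.
  have iy : mu.-integrable `[s, t] (EFin \o 'D_1 y).
    apply: (@le_integrable _ _ _ mu _ _ _ (cst C%:E)) => //.
    - exact/measurable_EFinP.
    - move=> x; rewrite /= in_itv/= => xst; rewrite lee_fin (le_trans (yC _ _))//; first by lra.
      exact: ler_norm.
    - apply: (@measurable_bounded_integrable _ _ _ mu (cst C)) => //.
      + by rewrite /= lebesgue_measure_itv/=; case: ifP => // _; rewrite -EFinD ltry.
      + exact: bounded_cst.
  rewrite /Rintegral fineK; last exact: integrable_fin_num.
  pose F : R -> \bar R := fun x => ('D_1 y x)%:E.
  (* The positive part is nonnegative and still below [m], so monotonicity without measurability
     applies to it. *)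
  have le1 : (\int[mu]_(x in `[s, t]) F x <= \int[mu]_(x in `[s, t]) F^\+%E x)%E.
    apply: le_integral => //; first exact: integrable_funepos.
    by move=> x _; rewrite funeposE le_max lexx.
  apply: (le_trans le1).
  apply: ge0_le_integral_nonmeas => //.
  - by move=> x; rewrite /= !in_itv/= => xst; lra.
  - move=> x; rewrite /= in_itv/= => xst.
    by rewrite funeposE ge_max m0 andbT; apply: ym; lra.
rewrite IE -EFinD lee_fin -lerBlDl.
have [_ ya yb] := (continuous_within_itvP y ab).1 cy.
(* One endpoint at a time: first [t] tends to [b] from the left, then [s] to [a] from the right. *)
have step2 s : a < s < b -> y b - y s <= fine I.
  move=> /andP[as_ sb]; rewrite lerBlDr.
  apply: (cvgr_to_le yb); near=> t.
  have st : s < t by near: t; exact: nbhs_left_gt.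
  have tb : t < b by near: t; exact: nbhs_left_lt.
  by rewrite -lerBlDr step.
rewrite lerBlDl -lerBlDr; apply: (cvgr_to_ge ya); near=> s.
have as_ : a < s by near: s; exact: nbhs_right_gt.
have sb : s < b by near: s; exact: nbhs_right_lt.
by rewrite lerBlDr addrC -lerBlDr step2// as_.
Unshelve. all: by end_near. Qed.

End bounded_derivative.

(** * Gronwall's inequality for the root of the energy *)

(* For [y = (E + eps)^(1/p) exp (L (T - t))] with [eps > 0] one has [y' <= m exp (L (T - t))]
   even where [E] vanishes; then [eps] is sent to 0. *)
Lemma gronwall_root (R : realType) (p L T C M : R) (E : R -> R) (m : R -> \bar R) :
  1 < p -> 0 < L -> 0 < T ->
  (forall t, 0 <= E t) ->
  (forall t, 0 <= t <= T -> E t <= M) ->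
  {within `[0, T], continuous E} ->
  (forall t, 0 < t < T -> derivable E t 1) ->
  (forall t, 0 < t < T -> `|'D_1 E t| <= C) ->
  (forall t, (0 <= m t)%E) ->
  (forall t, 0 < t < T ->
    (('D_1 E t)%:E <= (p * L * E t)%:E + (p * E t `^ (1 - p^-1))%:E * m t)%E) ->
  ((E T `^ p^-1)%:E <= (expR (L * T))%:E * (E 0 `^ p^-1)%:E +
     \int[lebesgue_measure]_(t in `[0%R, T]) ((expR (L * (T - t)))%:E * m t))%E.
Proof.
move=> p1 L0 T0 E0 EM cE dE EC m0 Em.
have p0 : 0 < p by exact: lt_trans p1.
pose q := p^-1; have q0 : 0 < q by rewrite invr_gt0.
have q1 : q < 1 by rewrite invf_lt1.
have pq : p * q = 1 by rewrite mulfV// gt_eqF.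
set I := (\int[_]_(t in _) _)%E.
apply/lee_addgt0Pr => eta' eta'0.
(* The factor [expR (L * T)] will turn [eta] into the margin [eta'], and [eps] is the solution of
   [(E 0 + eps)^q = (E 0)^q + eta]. *)
pose eta := eta' / expR (L * T).
have eta0 : 0 < eta by rewrite divr_gt0// expR_gt0.
pose eps := (E 0 `^ q + eta) `^ p - E 0.
have eps0 : 0 < eps.
  rewrite subr_gt0 -{1}(powRr1 (E0 0)) -[X in _ `^ X < _](mulVf (lt0r_neq0 p0)).
  by rewrite powRrM gt0_ltr_powR// ?nnegrE ?addr_ge0 ?powR_ge0 ?ltW// ltrDl.
have X0 t : 0 < E t + eps by rewrite ltr_wpDl.
pose y t := (E t + eps) `^ q * expR (L * (T - t)).
have dexp (t : R) : is_derive t 1 (fun t : R => expR (L * (T - t))) (- (L * expR (L * (T - t)))).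
  have dl : is_derive t 1 (fun t : R => L * (T - t)) (- L).
    have := is_deriveZ L (is_deriveB (is_derive_cst T t 1) (is_derive_id t 1)).
    by rewrite sub0r [L *: _]mulrN1.
  by have := is_derive_comp_dir dl (is_derive_expR _); rewrite mulrN mulrC.
have dX (t : R) : 0 < t < T ->
    is_derive t 1 (fun t : R => (E t + eps) `^ q) (q * (E t + eps) `^ (q - 1) * 'D_1 E t).
  move=> tT; have dEe : is_derive t 1 (fun t : R => E t + eps) ('D_1 E t).
    rewrite -[X in is_derive _ _ _ X]addr0.
    exact: (is_deriveD (derivableP (dE t tT)) (is_derive_cst eps t 1)).
  exact: (is_derive_comp_dir dEe (is_derive1_powR q (X0 t))).
have dy (t : R) : 0 < t < T -> is_derive t 1 y
    (expR (L * (T - t)) * (q * (E t + eps) `^ (q - 1) * 'D_1 E t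
      - L * (E t + eps) `^ q)).
  move=> tT; apply: (is_derive_eq (is_deriveM (dX t tT) (dexp t))).
  by rewrite /= ![_ *: _]mulrC; ring.
have Xq1 t : (E t + eps) `^ (q - 1) = ((E t + eps) `^ (1 - q))^-1.
  by rewrite -powRN opprB.
have Xq t : (E t + eps) `^ (q - 1) * (E t + eps) = (E t + eps) `^ q.
  by rewrite mulrC mulr_powRB1// ltW.
(* As [q - 1 < 0], the lower bound [eps] on [E t + eps] keeps this factor bounded, and with it the
   derivative of [y], even where [E] vanishes. *)
have Xeps t : (E t + eps) `^ (q - 1) <= eps `^ (q - 1).
  rewrite Xq1 -[q - 1]opprB powRN lef_pV2 ?posrE ?powR_gt0//.
  by rewrite ge0_ler_powR ?nnegrE ?lerDr ?E0 ?(ltW eps0) ?(ltW (X0 t)) ?subr_ge0 ?(ltW q1)//.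
have cpow x : 0 < x -> {for x, continuous (fun z : R => z `^ q)}.
  move=> x0; apply: derivable_continuous.
  by have [] := is_derive1_powR q x0.
have cexp (t : R) : {for t, continuous (fun t : R => expR (L * (T - t)))}.
  by apply: derivable_continuous; have [] := dexp t.
have cX (F : set_system R) (s : R) : Filter F -> E @ F --> E s ->
    (fun t => (E t + eps) `^ q) @ F --> (E s + eps) `^ q.
  move=> FF Es; have Ee : (fun t => E t + eps) @ F --> E s + eps.
    by apply: cvgD => //; exact: cvg_cst.
  exact: (continuous_cvg FF (@cpow _ (X0 s)) Ee).
have cy : {within `[0, T], continuous y}.
  have [_ E0c ETc] := (continuous_within_itvP E T0).1 cE.
  apply/(continuous_within_itvP y T0); split.
  - move=> t; rewrite in_itv/= => tT.
    by apply: derivable_continuous; have [] := dy t tT.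
  - exact: (cvgM (cX _ _ _ E0c) (cvg_at_right_filter (@cexp 0))).
  - exact: (cvgM (cX _ _ _ ETc) (cvg_at_left_filter (@cexp T))).
have expT t : 0 < t < T -> expR (L * (T - t)) <= expR (L * T).
  by move=> /andP[t0 _]; rewrite ler_expR ler_pM2l// gerBl ltW.
have yC t : 0 < t < T ->
    `|'D_1 y t| <= expR (L * T) * (q * eps `^ (q - 1) * C + L * (M + eps) `^ q).
  move=> tT; have [_ ->] := dy t tT.
  rewrite normrM (ger0_norm (expR_ge0 _)) ler_pM ?expR_ge0 ?expT//.
  apply: (le_trans (ler_normB _ _)); apply: lerD.
    rewrite normrM ger0_norm; last by rewrite mulr_ge0 ?powR_ge0 ?ltW.
    by rewrite ler_pM ?EC// ?mulr_ge0 ?powR_ge0 ?ler_pM2l// ltW.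
  rewrite ger0_norm; last by rewrite mulr_ge0 ?powR_ge0 ?ltW.
  have EtM : E t <= M by apply: EM; lra.
  rewrite ler_pM2l// ge0_ler_powR ?nnegrE ?lerD2r ?(ltW q0) ?(ltW (X0 t))//.
  by rewrite (le_trans (ltW (X0 t)))// lerD2r.
have ym t : 0 < t < T -> (('D_1 y t)%:E <= (expR (L * (T - t)))%:E * m t)%E.
  move=> tT; have [_ ->] := dy t tT.
  (* If [m t] is infinite, so is the right-hand side; the remaining case is a real number [n]. *)
  have := Em t tT; have := m0 t; case: (m t) => [n|_ _|//]; last first.
    by rewrite gt0_muley ?lte_fin ?expR_gt0// leey.
  rewrite lee_fin -EFinM -EFinD -EFinM !lee_fin => n0 Et.
  rewrite ler_pM2l ?expR_gt0// lerBlDr.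
  set a := (E t + eps) `^ (q - 1).
  have a0 : 0 < a by rewrite powR_gt0.
  (* The weight [a] is the inverse of [(E t + eps)^(1 - q)], which dominates [(E t)^(1 - q)]. *)
  have aB : a * E t `^ (1 - q) <= 1.
    rewrite /a Xq1 mulrC ler_pdivrMr ?powR_gt0// mul1r.
    by rewrite ge0_ler_powR ?nnegrE ?lerDl ?E0 ?(ltW eps0) ?(ltW (X0 t)) ?subr_ge0 ?(ltW q1)//.
  have aE : a * E t <= (E t + eps) `^ q.
    by rewrite -Xq ler_pM2l// lerDl ltW.
  have qa : 0 <= q * a by rewrite mulr_ge0// ltW.
  have {}Et : 'D_1 E t <= p * L * E t + p * E t `^ (1 - q) * n by [].
  apply: (le_trans (ler_wpM2l qa Et)).
  (* Since [p * q = 1], multiplication by [q * a] removes [p] from both terms; the term in [L] is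
     then absorbed by the one that comes from differentiating the exponential. *)
  have -> : q * a * (p * L * E t + p * E t `^ (1 - q) * n) =
      (p * q) * (L * (a * E t) + a * E t `^ (1 - q) * n) by ring.
  rewrite pq mul1r addrC lerD//; last by rewrite ler_pM2l.
  by rewrite ler_piMl.
have := le_integral_derive1 T0 cy (fun t tT => @ex_derive _ _ _ _ _ _ _ (dy t tT)) yC _ ym.
have yT : y T = (E T + eps) `^ q by rewrite /y subrr mulr0 expR0 mulr1.
have y0 : y 0 = (E 0 `^ q + eta) * expR (L * T).
  rewrite /y subr0 /eps subrKC -powRrM pq powRr1//.
  by rewrite addr_ge0 ?powR_ge0// ltW.
rewrite -/I yT y0 => H.
apply: (le_trans (le_trans _ (H _))).
- by rewrite lee_fin ge0_ler_powR ?nnegrE ?lerDl ?E0 ?(ltW q0) ?(ltW eps0) ?(ltW (X0 T)).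
- by move=> t; rewrite mule_ge0// lee_fin expR_ge0.
rewrite mulrDl divfK ?gt_eqF ?expR_gt0// [_ * expR _]mulrC EFinD EFinM.
by rewrite addeAC.
Qed.

(** * Measurability of the derivatives of a regular field on phase space *)

Section measurability.
Context (R : realType) (d : nat).
Context (dXi : measure_display) (Xi : measurableType dXi).
Context (v : Xi -> 'rV[R]_d) (v_meas : measurable_fun setT v).
Context (V : topologicalLmodType R) (ev : {linear V -> (Xi -> R^o)}).
Variables (T : R) (g : R -> 'rV[R]_d -> V).
Hypothesis g_reg : regular_field ev T g.

Lemma measurable_dt (t : R) : 0 < t < T ->
  measurable_fun setT (fun z : 'rV[R]_d * Xi => dt ev g t z.1 z.2).
Proof.
have [_ dg _ mg] := g_reg.
(* Steps of at most [T - t] keep [h n + t] in [[0, T]], where the time slices of [g] are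
   measurable. *)
move=> tT; pose h n : R := (T - t) / n.+1%:R.
have h0 n : 0 < h n by rewrite divr_gt0//; lra.
have hT n : h n <= T - t.
  by rewrite ler_pdivrMr// ler_peMr ?ler1n//; lra.
apply: (measurable_fun_cvg (h := fun n (z : 'rV[R]_d * Xi) =>
    (h n)^-1 * (ev (g (h n + t) z.1) z.2 - ev (g t z.1) z.2))).
  move=> n; apply: measurable_funM => //.
  by apply: measurable_funB; apply: mg; have := h0 n; have := hT n; lra.
move=> [x xi] _; apply: cvg_derive1.
- exact: dg.
- by move=> n; rewrite gt_eqF.
- exact: cvg_cst_harmonic.
Qed.

Lemma measurable_partial_x (t : R) (i : 'I_d) : 0 < t < T ->
  measurable_fun setT (fun z : 'rV[R]_d * Xi =>
    partial_x i (fun y => ev (g t y) z.2) z.1).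
Proof.
have [_ _ dg mg] := g_reg.
move=> tT; have mgt := mg t; pose h n : R := 1 / n.+1%:R.
apply: (measurable_fun_cvg (h := fun n (z : 'rV[R]_d * Xi) =>
    (h n)^-1 * (ev (g t (h n *: delta_mx ord0 i + z.1)) z.2 - ev (g t z.1) z.2))).
  move=> n; apply: measurable_funM => //.
  apply: measurable_funB; last by apply: mg; lra.
  have mshift : measurable_fun setT (fun z : 'rV[R]_d * Xi =>
      (h n *: delta_mx ord0 i + z.1, z.2)).
    apply: measurable_fun_pair; last exact: measurable_snd.
    apply: measurable_fun_rVP => j; under eq_fun do rewrite mxE.
    apply: measurable_funD => //.
    by apply: (measurableT_comp (measurable_coord_rV j)); exact: measurable_fst.
  by apply: (measurableT_comp (mgt _) mshift); lra.
move=> [x xi] _; apply: cvg_diff_quotient.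
- exact: dg.
- by move=> n; rewrite gt_eqF// divr_gt0.
- exact: cvg_cst_harmonic.
Qed.

Lemma measurable_v_grad (t : R) : 0 < t < T ->
  measurable_fun setT (fun z : 'rV[R]_d * Xi => v_grad v ev g t z.1 z.2).
Proof.
move=> tT; apply: measurable_sum => i.
apply: measurable_funM; last exact: measurable_partial_x.
apply: (measurableT_comp (measurable_coord_rV i)).
by apply: (measurableT_comp v_meas); exact: measurable_snd.
Qed.
End measurability.

(** * The p-th power of the norm as a function of time *)

Lemma within_continuous_norm_powR (R : realType) (y : R -> R) (a b p : R) : 1 < p ->
  {within `[a, b], continuous y} -> {within `[a, b], continuous (fun t => `|y t| `^ p)}.
Proof.
move=> p1 cy x.
apply: (@continuous_comp (subspace `[a, b]%classic) R R y (fun z => `|z| `^ p)).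
  exact: cy.
by apply: derivable_continuous; have [] := is_derive_norm_powR (y x) p1.
Qed.

Lemma le_dist_bounded_derive (R : realType) (y : R -> R) (a b C : R) :
  {within `[a, b], continuous y} ->
  (forall t, a < t < b -> derivable y t 1) ->
  (forall t, a < t < b -> `|'D_1 y t| <= C) ->
  forall s t, a <= s <= b -> a <= t <= b -> `|y t - y s| <= C * `|t - s|.
Proof.
move=> cy dy yC s t.
wlog st : s t / s < t.
  move=> H sab tab; have [st|ts|->] := ltgtP s t; first exact: H.
    by rewrite distrC [X in _ * X]distrC H.
  by rewrite !subrr normr0 mulr0.
move=> /andP[as_ sb] /andP[at_ tb].
have [x||c] := @MVT _ y ('D_1 y) s t st.
- by rewrite in_itv/= => xst; apply: derivableP; apply: dy; lra.
- apply: continuous_subspaceW cy => x; rewrite /= !in_itv/= => xst; lra.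
rewrite in_itv/= => cst ->; rewrite normrM ler_wpM2r// yC//; lra.
Qed.

Section power_of_norm.
Context d (Z : measurableType d) (R : realType) (mu : {measure set Z -> \bar R}).
Variables (p T : R) (e : R -> Z -> R) (G : Z -> R).
Hypotheses (p1 : 1 < p) (T0 : 0 < T).
Hypothesis ce : forall z, {within `[0, T], continuous (e ^~ z)}.
Hypothesis de : forall t z, 0 < t < T -> derivable (e ^~ z) t 1.
Hypothesis me : forall t, 0 <= t <= T -> measurable_fun setT (e t).
Hypothesis iG : mu.-integrable setT (EFin \o G).
Hypothesis eG : forall t z, 0 < t < T -> `|'D_1 (fun s => `|e s z| `^ p : R) t| <= G z.

Let A t z : R := `|e t z| `^ p.
Let E t := (\int[mu]_z A t z)%R.
Let CG := (\int[mu]_z G z)%R.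

Lemma measurable_power t : 0 <= t <= T -> measurable_fun setT (A t).
Proof.
move=> tT; apply: (@measurableT_comp _ _ _ _ _ _ (fun x : R => x `^ p)) => //.
by apply: measurableT_comp => //; exact: me.
Qed.

(** [G z] bounds the time derivative at interior times, and the mean value theorem extends the bound
    to increments up to the endpoints. Integrability and continuity in time both rest on this. *)
Lemma power_lipschitz s t z : 0 <= s <= T -> 0 <= t <= T ->
  `|A t z - A s z| <= G z * `|t - s|.
Proof.
apply: (@le_dist_bounded_derive R (A ^~ z) 0 T (G z)).
- exact: within_continuous_norm_powR.
- move=> x xT; have dx := derivableP (@de _ z xT).
  by have [] := is_derive_norm_powR_comp p1 dx.
- by move=> x xT; exact: eG.
Qed.

Lemma dominating_ge0 z : 0 <= G z.
Proof.
have hT : 0 < T / 2 < T by have := T0; lra.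
exact: le_trans (normr_ge0 _) (eG z hT).
Qed.

Hypothesis i0 : mu.-integrable setT (EFin \o A 0).

(** The Lipschitz bound gives [A t z <= A 0 z + T * G z], so finiteness of the norm at time 0
    propagates to [[0, T]]. *)
Lemma integrable_power t : 0 <= t <= T -> mu.-integrable setT (EFin \o A t).
Proof.
move=> tT.
apply: (@le_integrable _ _ _ mu _ _ _ (fun z => (A 0 z)%:E + T%:E * (G z)%:E)%E) => //.
- by apply/measurable_EFinP; exact: measurable_power.
- move=> z _ /=; rewrite lee_fin.
  have A0 s : 0 <= A s z by exact: powR_ge0.
  have G0 := dominating_ge0 z.
  rewrite !ger0_norm ?addr_ge0 ?mulr_ge0 ?(ltW T0)//.
  have zT : 0 <= (0 : R) <= T by rewrite lexx ltW.
  have := power_lipschitz z zT tT; rewrite subr0 => H.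
  rewrite -lerBlDl (le_trans (ler_norm _))// (le_trans H)// mulrC ler_wpM2r//.
  by rewrite ger0_norm; lra.
- apply: integrableD => //; exact: integrableZl.
Qed.

Lemma integral_power_lipschitz s t : 0 <= s <= T -> 0 <= t <= T ->
  `|E t - E s| <= CG * `|t - s|.
Proof.
move=> sT tT.
have iB : mu.-integrable setT (EFin \o (fun z => A t z - A s z)).
  have := integrableB measurableT (integrable_power tT) (integrable_power sT).
  by apply: eq_integrable.
rewrite /E -RintegralB//; [|exact: integrable_power..].
apply: (le_trans (le_normr_Rintegral _ _)) => //.
rewrite /CG [_ * `|_|]mulrC -RintegralZl//.
apply: le_Rintegral => //.
- have := integrable_abse iB.
  by apply: eq_integrable.
- have := integrableZl measurableT (`|t - s|) iG.
  by apply: eq_integrable.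
- by move=> z _; rewrite mulrC power_lipschitz.
Qed.

Lemma within_continuous_integral_power : {within `[0, T], continuous E}.
Proof.
have H := integral_power_lipschitz.
have CG0 : 0 <= CG by apply: Rintegral_ge0 => z _; exact: dominating_ge0.
apply/subspace_continuousP => x; rewrite /= in_itv/= => xT.
apply/cvgrPdist_le => eps eps0.
(* Adding 1 keeps the divisor positive when [CG = 0]. *)
have e1 : 0 < eps / (CG + 1) by rewrite divr_gt0// ltr_wpDl.
rewrite near_withinE; near=> t; rewrite /= in_itv/= => tT.
apply: (le_trans (H _ _ tT xT)).
have xt : `|x - t| <= eps / (CG + 1) by near: t; exact: cvgr_dist_le.
apply: (@le_trans _ _ ((CG + 1) * (eps / (CG + 1)))).
  by rewrite ler_pM// lerDl.
by rewrite mulrCA divff ?mulr1// gt_eqF// ltr_wpDl.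
Unshelve. all: by end_near. Qed.

Lemma is_derive_integral_power (t : R) : 0 < t < T ->
  is_derive t 1 E (\int[mu]_z 'D_1 (A ^~ z) t)%R.
Proof.
move=> tT.
have It : `]0, T[%classic t by rewrite /= in_itv.
have iA x : `]0, T[%classic x -> mu.-integrable setT (EFin \o A x).
  by rewrite /= in_itv/= => xT; apply: integrable_power; lra.
have dA x z : `]0, T[%classic x -> setT z -> derivable (A ^~ z) x 1.
  rewrite /= in_itv/= => xT _; have dx := derivableP (@de _ z xT).
  by have [] := is_derive_norm_powR_comp p1 dx.
have Gb x z : `]0, T[%classic x -> setT z -> `|partial1of2 A x z| <= G z.
  by rewrite /= in_itv/= => xT _; rewrite partial1of2E; exact: eG.
split.
  exact: (derivable_under_integral measurableT It iA dA dominating_ge0 iG Gb).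
rewrite -derive1E.
rewrite (differentiation_under_integral measurableT It iA dA dominating_ge0 iG Gb).
by apply: eq_Rintegral => z _; rewrite partial1of2E.
Qed.

Lemma measurable_derive_power t : 0 < t < T ->
  measurable_fun setT (fun z => 'D_1 (A ^~ z) t).
Proof.
move=> tT; pose h n : R := (T - t) / n.+1%:R.
have h0 n : 0 < h n by rewrite divr_gt0//; lra.
have hT n : h n <= T - t.
  by rewrite ler_pdivrMr// ler_peMr ?ler1n//; lra.
apply: (measurable_fun_cvg (h := fun n z => (h n)^-1 * (A (h n + t) z - A t z))).
  move=> n; apply: measurable_funM => //; apply: measurable_funB;
    by apply: measurable_power; have := h0 n; have := hT n; lra.
move=> z _; apply: cvg_derive1.
- have dx := derivableP (@de _ z tT).
  by have [] := is_derive_norm_powR_comp p1 dx.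
- by move=> n; rewrite gt_eqF.
- exact: cvg_cst_harmonic.
Qed.

Lemma integrable_derive_power t : 0 < t < T ->
  mu.-integrable setT (fun z => ('D_1 (A ^~ z) t)%:E).
Proof.
move=> tT; apply: (@le_integrable _ _ _ mu _ _ _ (EFin \o G)) => //.
- by apply/measurable_EFinP; exact: measurable_derive_power.
- by move=> z _; rewrite /= lee_fin (le_trans (@eG _ _ _))// ler_norm.
Qed.

End power_of_norm.

(** * Hoelder's inequality and the Gronwall estimate for the norm *)

Section Lp_estimates.
Context d (Z : measurableType d) (R : realType) (mu : {measure set Z -> \bar R}).
Variables (p : R) (p1 : 1 < p).

Let p0 : 0 < p. Proof. exact: lt_trans p1. Qed.

Lemma Lnorm_powR (u : Z -> R) :
  ('N[mu]_p%:E[EFin \o u] = (\int[mu]_z (`|u z| `^ p)%:E) `^ p^-1)%E.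
Proof. by rewrite unlock. Qed.

Lemma Lnorm_Rintegral (u : Z -> R) :
  mu.-integrable setT (EFin \o (fun z => `|u z| `^ p)) ->
  ('N[mu]_p%:E[EFin \o u] = ((\int[mu]_z (`|u z| `^ p))%R `^ p^-1)%:E)%E.
Proof.
move=> iu; rewrite Lnorm_powR -poweR_EFin /Rintegral fineK//.
exact: integrable_fin_num.
Qed.

Lemma integrable_Lnorm_fin (u : Z -> R) : measurable_fun setT u ->
  ('N[mu]_p%:E[EFin \o u] < +oo)%E ->
  mu.-integrable setT (EFin \o (fun z => `|u z| `^ p)).
Proof.
move=> mU; rewrite Lnorm_powR => /lty_poweRy H.
apply/integrableP; split.
  apply/measurable_EFinP; apply: (@measurableT_comp _ _ _ _ _ _ (fun x : R => x `^ p)) => //.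
  exact: measurableT_comp.
apply: le_lt_trans (H _); last by rewrite invr_neq0// gt_eqF.
rewrite le_eqVlt; apply/orP; left; apply/eqP; apply: eq_integral => z _ /=.
by rewrite ger0_norm// powR_ge0.
Qed.

(** Hoelder's inequality with exponents [q = p / (p - 1)] and [p]: the [q]-th power of [|e|^(p - 1)]
    is [|e|^p], and [1 / q = 1 - 1 / p]. The norm of [r] may be infinite. *)
Lemma hoelder_power (e r : Z -> R) :
  measurable_fun setT e -> measurable_fun setT r ->
  mu.-integrable setT (EFin \o (fun z => `|e z| `^ p)) ->
  (\int[mu]_z (`|e z| `^ (p - 1) * `|r z|)%:E <=
   ((\int[mu]_z (`|e z| `^ p))%R `^ (1 - p^-1))%:E * 'N[mu]_p%:E[EFin \o r])%E.
Proof.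
move=> mE mr iE.
pose w z := `|e z| `^ (p - 1); pose q := p / (p - 1).
have p10 : 0 < p - 1 by rewrite subr_gt0.
have q0 : 0 < q by rewrite divr_gt0.
have mw : measurable_fun setT w.
  apply: (@measurableT_comp _ _ _ _ _ _ (fun x : R => x `^ (p - 1))) => //.
  exact: measurableT_comp.
have qV : q^-1 = 1 - p^-1.
  by rewrite /q invf_div mulrBl divff ?gt_eqF// mul1r.
have := hoelder mu mw mr q0 p0; rewrite qV subrK => /(_ erefl).
rewrite Lnorm1; have -> : ('N[mu]_q%:E[EFin \o w] =
    ((\int[mu]_z (`|e z| `^ p))%R `^ (1 - p^-1))%:E)%E.
  rewrite unlock qV -poweR_EFin /Rintegral fineK; last exact: integrable_fin_num.
  congr (_ `^ _)%E; apply: eq_integral => z _ /=.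
  rewrite ger0_norm ?powR_ge0// /w -powRrM /q mulrCA divff ?mulr1// gt_eqF//.
congr (_ <= _)%E; apply: eq_integral => z _ /=.
by rewrite normrM ger0_norm ?powR_ge0.
Qed.

(** [B] stands for the time derivative of [|e|^p] plus its transport term, [r] for the residual and
    [q] for the difference of the collision terms. The assumed integral bound controls the part with
    [q], Hoelder's inequality the part with [r]. *)
Lemma le_Rintegral_weighted (e r q B : Z -> R) (L : R) : 0 <= L ->
  measurable_fun setT e -> measurable_fun setT r -> measurable_fun setT q ->
  mu.-integrable setT (EFin \o (fun z => `|e z| `^ p)) ->
  mu.-integrable setT (EFin \o B) ->
  (forall z, `|B z| <= p * (`|e z| `^ (p - 1) * (`|r z| + `|q z|))) ->
  (\int[mu]_z (`|e z| `^ (p - 1) * `|q z|)%:E <=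
   L%:E * \int[mu]_z (`|e z| `^ p)%:E)%E ->
  ((\int[mu]_z B z)%R%:E <=
   (p * L * (\int[mu]_z (`|e z| `^ p))%R)%:E +
   (p * (\int[mu]_z (`|e z| `^ p))%R `^ (1 - p^-1))%:E * 'N[mu]_p%:E[EFin \o r])%E.
Proof.
move=> L0 mE mr mq iE iB HB Hq.
have mw : measurable_fun setT (fun z => `|e z| `^ (p - 1)).
  apply: (@measurableT_comp _ _ _ _ _ _ (fun x : R => x `^ (p - 1))) => //.
  exact: measurableT_comp.
have mwr (u : Z -> R) : measurable_fun setT u ->
    measurable_fun setT (fun z => (`|e z| `^ (p - 1) * `|u z|)%:E).
  move=> mU; apply/measurable_EFinP/measurable_funM => //.
  exact: measurableT_comp.
have w0 (u : Z -> R) z : (0 <= (`|e z| `^ (p - 1) * `|u z|)%:E)%E.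
  by rewrite lee_fin mulr_ge0// powR_ge0.
apply: (@le_trans _ _ (p%:E * \int[mu]_z (`|e z| `^ (p - 1) * `|q z|)%:E +
    p%:E * \int[mu]_z (`|e z| `^ (p - 1) * `|r z|)%:E)%E).
  rewrite -!ge0_integralZl//; [|exact: mwr|exact: ltW|exact: mwr|exact: ltW].
  rewrite -ge0_integralD//; last 4 first.
  - by move=> z _; rewrite mule_ge0// lee_fin ltW.
  - by apply: measurable_funeM; exact: mwr.
  - by move=> z _; rewrite mule_ge0// lee_fin ltW.
  - by apply: measurable_funeM; exact: mwr.
  rewrite /Rintegral fineK; last exact: integrable_fin_num.
  apply: (le_trans (lee_abs _)).
  apply: (le_trans (le_abse_integral _ _ _)) => //; first by case/integrableP: iB.
  apply: ge0_le_integral_nonmeas => //.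
  - by move=> z _; rewrite adde_ge0// mule_ge0// lee_fin ltW.
  - move=> z _; rewrite -!EFinM -EFinD lee_fin (le_trans (HB z))//.
    by rewrite -mulrDr -mulrDr [`|q z| + _]addrC.
apply: leeD.
  rewrite -mulrA EFinM lee_pmul2l ?lte_fin//.
  apply: (le_trans Hq); rewrite EFinM /Rintegral fineK//.
  exact: integrable_fin_num.
by rewrite EFinM -muleA lee_pmul2l ?lte_fin//; exact: hoelder_power.
Qed.

(** Domination by [G] supplies all the regularity in time of the integral of [|e t|^p] that
    [gronwall_root] asks for; [He] is its differential inequality. *)
Lemma Lnorm_gronwall (T L : R) (e : R -> Z -> R) (G : Z -> R) (m : R -> \bar R) :
  0 < L -> 0 <= T ->
  (forall z, {within `[0, T], continuous (e ^~ z)}) ->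
  (forall t z, 0 < t < T -> derivable (e ^~ z) t 1) ->
  (forall t, 0 <= t <= T -> measurable_fun setT (e t)) ->
  mu.-integrable setT (EFin \o G) ->
  (forall t z, 0 < t < T -> `|'D_1 (fun s => `|e s z| `^ p : R) t| <= G z) ->
  (forall t, (0 <= m t)%E) ->
  (forall t, 0 < t < T -> mu.-integrable setT (EFin \o (fun z => `|e t z| `^ p)) ->
    mu.-integrable setT (fun z => ('D_1 (fun s => `|e s z| `^ p : R) t)%:E) ->
    ((\int[mu]_z 'D_1 (fun s => `|e s z| `^ p : R) t)%R%:E <=
     (p * L * (\int[mu]_z (`|e t z| `^ p))%R)%:E +
     (p * (\int[mu]_z (`|e t z| `^ p))%R `^ (1 - p^-1))%:E * m t)%E) ->
  ('N[mu]_p%:E[EFin \o e T] <=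
   (expR (L * T))%:E * 'N[mu]_p%:E[EFin \o e 0%R] +
   \int[lebesgue_measure]_(t in `[0%R, T]) ((expR (L * (T - t)))%:E * m t))%E.
Proof.
move=> L0; rewrite le_eqVlt => /predU1P[<-|T0] ce de me iG eG m0 He.
  rewrite mulr0 expR0 mul1e leeDl// integral_ge0// => t _.
  by rewrite mule_ge0// lee_fin expR_ge0.
set I := (\int[_]_(t in _) _)%E.
have I0 : (0 <= I)%E.
  by apply: integral_ge0 => t _; rewrite mule_ge0// lee_fin expR_ge0.
(* An infinite initial norm makes the right-hand side infinite; a finite one yields integrability at
   time 0. *)
have [->|N0] := eqVneq ('N[mu]_p%:E[EFin \o e 0%R])%E +oo%E.
  rewrite gt0_muley ?lte_fin ?expR_gt0// addye ?leey//.
  by rewrite gt_eqF// (lt_le_trans _ I0)// ltNy0.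
have zT : 0 <= (0 : R) <= T by rewrite lexx ltW.
have TT : 0 <= T <= T by rewrite lexx ltW.
have i0 : mu.-integrable setT (EFin \o (fun z => `|e 0 z| `^ p)).
  by apply: integrable_Lnorm_fin; [exact: me|rewrite ltey].
have iE t : 0 <= t <= T -> mu.-integrable setT (EFin \o (fun z => `|e t z| `^ p)).
  by move=> tT; exact: (integrable_power p1 T0 ce de me iG eG i0 tT).
have CG0 : 0 <= (\int[mu]_z G z)%R.
  by apply: Rintegral_ge0 => z _; exact: (dominating_ge0 T0 eG).
have lip := integral_power_lipschitz p1 T0 ce de me iG eG i0.
have dE t tT := is_derive_integral_power p1 T0 ce de me iG eG i0 (t := t) tT.
have cE := within_continuous_integral_power p1 T0 ce de me iG eG i0.
rewrite !Lnorm_Rintegral; [|exact: iE..].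
(* The integral of [G] is a Lipschitz constant of the energy, hence serves as [C], and the energy
   grows by at most [T] times it, which gives [M]. *)
apply: (gronwall_root (E := fun t => (\int[mu]_z (`|e t z| `^ p))%R)
  (C := (\int[mu]_z G z)%R)
  (M := (\int[mu]_z (`|e 0 z| `^ p))%R + (\int[mu]_z G z)%R * T)) => //.
- by move=> t; apply: Rintegral_ge0 => z _; exact: powR_ge0.
- move=> t tT; rewrite -lerBlDl (le_trans (ler_norm _))// (le_trans (lip _ _ zT tT))//.
  by rewrite ler_wpM2l// subr0 ger0_norm; lra.
- by move=> t tT; have [] := dE t tT.
- move=> t tT; have [_ ->] := dE t tT.
  have iD := integrable_derive_power p1 de me iG eG tT.
  apply: (le_trans (le_normr_Rintegral _ _)) => //.
  apply: le_Rintegral => //; last by move=> z _; exact: eG.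
  have := integrable_abse iD; exact: eq_integrable.
- move=> t tT; have [_ ->] := dE t tT.
  apply: He => //; first by apply: iE; lra.
  exact: (integrable_derive_power p1 de me iG eG tT).
Qed.

End Lp_estimates.

(** * The evolution equation of the error and its energy inequality *)

Section error_equation.
Context (R : realType) (d : nat).
Context (dXi : measure_display) (Xi : measurableType dXi).
Context (mu : {sigma_finite_measure set Xi -> \bar R}).
Context (v : Xi -> 'rV[R]_d) (v_meas : measurable_fun setT v).
Context (V : topologicalLmodType R) (ev : {linear V -> (Xi -> R^o)}).
Variables (p T : R) (p1 : 1 < p).
Variables (g f : R -> 'rV[R]_d -> V).
Hypotheses (g_reg : regular_field ev T g) (f_reg : regular_field ev T f).

Lemma error_is_derive_dt (t : R) (z : 'rV[R]_d * Xi) : 0 < t < T ->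
  is_derive t 1 ((error ev g f) ^~ z) (dt ev g t z.1 z.2 - dt ev f t z.1 z.2).
Proof.
move=> tT; have [_ dg _ _] := g_reg; have [_ df _ _] := f_reg.
exact: (is_deriveB (derivableP (dg _ z.1 z.2 tT)) (derivableP (df _ z.1 z.2 tT))).
Qed.

Lemma measurable_error (t : R) : 0 <= t <= T -> measurable_fun setT (error ev g f t).
Proof.
move=> tT; have [_ _ _ mg] := g_reg; have [_ _ _ mf] := f_reg.
by apply: measurable_funB; [exact: mg|exact: mf].
Qed.

Lemma within_continuous_error z : {within `[0, T], continuous ((error ev g f) ^~ z)}.
Proof.
have [cg _ _ _] := g_reg; have [cf _ _ _] := f_reg.
by move=> t; apply: continuousB; [exact: cg|exact: cf].
Qed.

Lemma transport_error_power (t : R) (z : 'rV[R]_d * Xi) : 0 < t < T ->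
  transport v (fun y => `|error ev g f t (y, z.2)| `^ p) z.2 z.1 =
  p * `|error ev g f t z| `^ (p - 1) * Num.sg (error ev g f t z) *
  (v_grad v ev g t z.1 z.2 - v_grad v ev f t z.1 z.2).
Proof.
move=> tT; have [_ _ dg _] := g_reg; have [_ _ df _] := f_reg.
case: z => x xi /=.
rewrite /v_grad /transport -sumrB mulr_sumr; apply: eq_bigr => i _.
have de : is_derive x (delta_mx ord0 i) (fun y => error ev g f t (y, xi))
    (partial_x i (fun y => ev (g t y) xi) x - partial_x i (fun y => ev (f t y) xi) x).
  exact: (is_deriveB (derivableP (dg _ x xi i tT)) (derivableP (df _ x xi i tT))).
have [_ dE] := is_derive_norm_powR_comp p1 de.
by rewrite {1}/partial_x dE; ring.
Qed.

(** By the chain rule the time derivative and the transport term share the factor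
    [p |e|^(p - 1) sgn e]. What it multiplies is the transport operator applied to [g - f], that is,
    the residual plus the difference of the collision terms. *)
Lemma error_power_equation (Q : V -> V) (t : R) (z : 'rV[R]_d * Xi) : 0 < t < T ->
  dt ev f t z.1 z.2 + v_grad v ev f t z.1 z.2 = ev (Q (f t z.1)) z.2 ->
  'D_1 (fun s => `|error ev g f s z| `^ p : R) t +
  transport v (fun y => `|error ev g f t (y, z.2)| `^ p) z.2 z.1 =
  p * `|error ev g f t z| `^ (p - 1) * Num.sg (error ev g f t z) *
  (residual v ev Q g t z + (ev (Q (g t z.1)) z.2 - ev (Q (f t z.1)) z.2)).
Proof.
move=> tT fE; rewrite transport_error_power//.
have [_ ->] := is_derive_norm_powR_comp p1 (error_is_derive_dt z tT).
by rewrite -fE /residual; ring.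
Qed.

(** The hypothesis on [Q] concerns functions of [xi] at a fixed position; Tonelli's theorem
    integrates it over all positions. *)
Lemma collision_phase_le (M : set V) (Q : V -> V) (LQ : R) (a b : 'rV[R]_d -> V) :
  0 <= LQ -> collision_lipschitz mu ev M Q p LQ ->
  (forall x, M (a x)) -> (forall x, M (b x)) ->
  measurable_fun setT (fun z : 'rV[R]_d * Xi => ev (a z.1) z.2 - ev (b z.1) z.2) ->
  measurable_fun setT (fun z : 'rV[R]_d * Xi => ev (Q (a z.1)) z.2 - ev (Q (b z.1)) z.2) ->
  (\int[phase_measure (d := d) mu]_z (`|ev (a z.1) z.2 - ev (b z.1) z.2| `^ (p - 1) *
      `|ev (Q (a z.1)) z.2 - ev (Q (b z.1)) z.2|)%:E <=
   LQ%:E * \int[phase_measure (d := d) mu]_z (`|ev (a z.1) z.2 - ev (b z.1) z.2| `^ p)%:E)%E.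
Proof.
move=> L0 HQ Ma Mb me mq.
have mpow r : measurable_fun setT (fun z : 'rV[R]_d * Xi =>
    `|ev (a z.1) z.2 - ev (b z.1) z.2| `^ r).
  apply: (@measurableT_comp _ _ _ _ _ _ (fun x : R => x `^ r)) => //.
  exact: measurableT_comp.
have m1 : measurable_fun setT (fun z : 'rV[R]_d * Xi =>
    (`|ev (a z.1) z.2 - ev (b z.1) z.2| `^ (p - 1) *
      `|ev (Q (a z.1)) z.2 - ev (Q (b z.1)) z.2|)%:E).
  apply/measurable_EFinP/measurable_funM => //; exact: measurableT_comp.
have m2 : measurable_fun setT (fun z : 'rV[R]_d * Xi =>
    (`|ev (a z.1) z.2 - ev (b z.1) z.2| `^ p)%:E).
  by apply/measurable_EFinP.
have f1 (z : 'rV[R]_d * Xi) : (0 <= (`|ev (a z.1) z.2 - ev (b z.1) z.2| `^ (p - 1) *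
      `|ev (Q (a z.1)) z.2 - ev (Q (b z.1)) z.2|)%:E)%E.
  by rewrite lee_fin mulr_ge0// powR_ge0.
have f2 (z : 'rV[R]_d * Xi) : (0 <= (`|ev (a z.1) z.2 - ev (b z.1) z.2| `^ p)%:E)%E.
  by rewrite lee_fin powR_ge0.
rewrite /phase_measure (fubini_tonelli1 _ m1 f1) (fubini_tonelli1 _ m2 f2).
have F2 x : (0 <= fubini_F mu (fun z : 'rV[R]_d * Xi =>
    (`|ev (a z.1) z.2 - ev (b z.1) z.2| `^ p)%:E) x)%E.
  by apply: integral_ge0 => xi _; exact: (f2 (x, xi)).
rewrite -ge0_integralZl//; last exact: measurable_fun_fubini_tonelli_F.
apply: ge0_le_integral_nonmeas => //.
- by move=> x _; apply: integral_ge0 => xi _; exact: (f1 (x, xi)).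
- by move=> x _; rewrite mule_ge0.
- move=> x _; rewrite /fubini_F /=.
  exact: (HQ (a x) (b x) (Ma x) (Mb x)).
Qed.

End error_equation.

(** The transport term has integral 0, so it may be added to the time derivative under the integral;
    the sum is then given pointwise by the error equation. *)
Lemma error_energy (R : realType) (d : nat)
    (dXi : measure_display) (Xi : measurableType dXi)
    (mu : {sigma_finite_measure set Xi -> \bar R})
    (v : Xi -> 'rV[R]_d) (v_meas : measurable_fun setT v)
    (V : topologicalLmodType R) (ev : {linear V -> (Xi -> R^o)})
    (M : set V) (Q : V -> V) (p LQ T t : R) (g f : R -> 'rV[R]_d -> V) :
  1 < p -> 0 <= LQ -> 0 < t < T -> collision_lipschitz mu ev M Q p LQ ->
  regular_field ev T g -> (forall x, M (g t x)) -> kinetic_solution v ev M Q T f ->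
  measurable_fun setT (fun z : 'rV[R]_d * Xi => ev (Q (g t z.1)) z.2) ->
  no_boundary_terms mu v ev p T g f ->
  let e := error ev g f in
  (phase_measure (d := d) mu).-integrable setT (EFin \o (fun z => `|e t z| `^ p)) ->
  (phase_measure (d := d) mu).-integrable setT
    (fun z => ('D_1 (fun s => `|e s z| `^ p : R) t)%:E) ->
  ((\int[phase_measure (d := d) mu]_z 'D_1 (fun s => `|e s z| `^ p : R) t)%R%:E <=
   (p * LQ * (\int[phase_measure (d := d) mu]_z (`|e t z| `^ p))%R)%:E +
   (p * (\int[phase_measure (d := d) mu]_z (`|e t z| `^ p))%R `^ (1 - p^-1))%:E *
     phase_norm mu p (residual v ev Q g t))%E.
Proof.
move=> p1 L0 tT HQ g_reg Mg [Mf f_reg fE] mQg bd e iE iD.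
have tT' : 0 <= t <= T by lra.
pose F (z : 'rV[R]_d * Xi) : R :=
  transport v (fun y => `|e t (y, z.2)| `^ p) z.2 z.1.
have [iF F0] : (phase_measure (d := d) mu).-integrable setT (EFin \o F) /\
  (\int[phase_measure (d := d) mu]_z (F z)%:E = 0)%E := bd t tT.
pose D z : R := 'D_1 (fun s => `|e s z| `^ p : R) t.
have F0' : (\int[phase_measure (d := d) mu]_z F z)%R = 0 by rewrite /Rintegral F0.
have iDF : (phase_measure (d := d) mu).-integrable setT (EFin \o (fun z => D z + F z)).
  have := integrableD measurableT iD iF; exact: eq_integrable.
have DF0 : (\int[phase_measure (d := d) mu]_z D z)%R =
    (\int[phase_measure (d := d) mu]_z (D z + F z))%R.
  by rewrite RintegralD// F0' addr0.
(* The kinetic equation expresses the collision term of [f] through derivatives of [f], which are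
   measurable. *)
have mQf : measurable_fun setT (fun z : 'rV[R]_d * Xi => ev (Q (f t z.1)) z.2).
  rewrite (_ : (fun z => _) = fun z => dt ev f t z.1 z.2 + v_grad v ev f t z.1 z.2).
    by apply: measurable_funD; [exact: (measurable_dt f_reg)|exact: (measurable_v_grad v_meas f_reg)].
  by apply/funext => z; rewrite fE.
rewrite -/(D _) DF0.
apply: (le_Rintegral_weighted p1 L0 (e := e t)
  (q := fun z => ev (Q (g t z.1)) z.2 - ev (Q (f t z.1)) z.2)) => //.
- exact: (measurable_error g_reg f_reg tT').
- apply: measurable_funB => //.
  by apply: measurable_funD; [exact: (measurable_dt g_reg)|exact: (measurable_v_grad v_meas g_reg)].
- exact: measurable_funB.
- move=> z; rewrite (error_power_equation p1 g_reg f_reg tT (fE _ _ _ tT)).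
  rewrite -mulrA normrM ger0_norm; last by rewrite mulr_ge0 ?powR_ge0// ltW// (lt_trans _ p1).
  rewrite mulrA ler_wpM2l//; first by rewrite mulr_ge0 ?powR_ge0// ltW// (lt_trans _ p1).
  (* The sign of the error has absolute value at most 1, and 0 where the error vanishes. *)
  rewrite normrM (le_trans _ (ler_normD _ _))// ler_piMl// normr_sg.
  by case: (_ == _).
- apply: (collision_phase_le L0 HQ Mg) => //.
  + by move=> x; exact: Mf.
  + exact: (measurable_error g_reg f_reg tT').
  + exact: measurable_funB.
Qed.

(** Gronwall's inequality amplifies the initial error by [expR (LQ * T)]. This factor is sharp: for
    [v = 0], [Q u = LQ *: u] and a vanishing residual, the error at time [T] is exactly
    [expR (LQ * T)] times the initial one. *)
Theorem theorem11 (R : realType) (d n : nat)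
    (dXi : measure_display) (Xi : measurableType dXi)
    (mu : {sigma_finite_measure set Xi -> \bar R})
    (v : Xi -> 'rV[R]_d) (v_meas : measurable_fun setT v)
    (V : topologicalLmodType R) (ev : {linear V -> (Xi -> R^o)})
    (V_space : function_space ev)
    (M : set V) (M_open : open M) (Q : V -> V)
    (fhat : 'rV[R]_n -> V) (fhat_M : ansatz_manifold ev fhat M)
    (P : 'rV[R]_n -> {linear V -> V})
    (P_proj : tangent_projection ev fhat P)
    (p LQ T : R) (p_gt1 : 1 < p) (LQ_gt0 : 0 < LQ) (T_ge0 : 0 <= T)
    (Q_lip : collision_lipschitz mu ev M Q p LQ)
    (f : R -> 'rV[R]_d -> V) (f_sol : kinetic_solution v ev M Q T f)
    (omega : R -> 'rV[R]_d -> 'rV[R]_n)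
    (omega_sol : reduced_solution v ev fhat Q P T omega)
    (Qfhat_meas : forall t : R, 0 < t < T ->
       measurable_fun setT
         (fun z : 'rV[R]_d * Xi => ev (Q (fhat (omega t z.1))) z.2))
    (decay_dt :
       dominated_dt mu ev p T (fun t x => fhat (omega t x)) f)
    (decay_bd :
       no_boundary_terms mu v ev p T (fun t x => fhat (omega t x)) f) :
  let g t x := fhat (omega t x) in
  (phase_norm mu p (error ev g f T) <=
   (expR (LQ * T)%R)%:E * phase_norm mu p (error ev g f 0%R) +
   \int[lebesgue_measure]_(tau in `[0%R, T])
     ((expR (LQ * (T - tau))%R)%:E *
      phase_norm mu p (residual v ev Q g tau)))%E.
Proof.
cbv zeta; set g := fun t x => fhat (omega t x).
have [G iG eG] := decay_dt.
have [g_reg _] := omega_sol; have [_ f_reg _] := f_sol.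
apply: (Lnorm_gronwall p_gt1 (e := error ev g f) (G := G)
  (m := fun t => phase_norm mu p (residual v ev Q g t))) => //.
- by move=> z; exact: (within_continuous_error g_reg f_reg).
- by move=> t z tT; have [] := error_is_derive_dt g_reg f_reg z tT.
- by move=> t tT; exact: (measurable_error g_reg f_reg tT).
- by move=> t; exact: Lnorm_ge0.
- move=> t tT iE iD.
  apply: (error_energy v_meas p_gt1 (ltW LQ_gt0) tT Q_lip) => //.
  + by move=> x; have [+ _] := fhat_M; exact.
  + exact: Qfhat_meas.
Qed.
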